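(* Let $c\in\mathbb{Q}^*$ and let $C_2\colon y^2=x^7-cx$ over $\mathbb{Q}$. Let $p>3$ be a prime with $v_p(c)=0$, let $n=(p-1)/2$, and let $\overline{c}$ denote the image of $c$ in $\mathbb{F}_p$. Then the trace of Frobenius satisfies $$t_p(C_2)\equiv\begin{cases}\binom{n}{n/2}(-\overline{c})^{n/2}+\binom{n}{n/6}(-\overline{c})^{n/6}+\binom{n}{n/6}(-\overline{c})^{5n/6}&\text{if }p\equiv 1\bmod 12,\\[2pt] \binom{n}{n/2}(-\overline{c})^{n/2}&\text{if }p\equiv 5\bmod 12,\\[2pt] 0&\text{otherwise,}\end{cases}\pmod p.$$
   Context: $C_2$ is a genus 3 hyperelliptic curve, and $t_p(C_2):=p+1-\#\overline{C}_2(\mathbb{F}_p)$, where $\overline{C}_2$ is the smooth projective curve over $\mathbb{F}_p$ that is the reduction of $C_2$ modulo the prime $p$ of good reduction. The congruence modulo $p$ means that the image of the integer $t_p(C_2)$ in $\mathbb{F}_p$ equals the indicated element of $\mathbb{F}_p$. *)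

(* Defs.v *)
From HB Require Import structures.
From mathcomp Require Import all_boot all_order all_algebra all_field.
From mathcomp Require Import ring.

Set Implicit Arguments.
Unset Strict Implicit.
Unset Printing Implicit Defensive.

Import Order.TTheory GRing.Theory Num.Theory.
Local Open Scope ring_scope.

(* p-adic valuation on rat; for q = 0 it returns 0 instead of +oo. *)
Definition padic_val (p : nat) (q : rat) : int :=
  (logn p `|numq q|)%:Z - (logn p `|denq q|)%:Z.

(* A hyperelliptic curve y^2 = f(x) is represented by the polynomial f.
   Since size f = deg f + 1, this is the floor of (deg f - 1) / 2. *)
Definition hyp_genus (F : fieldType) (f : {poly F}) : nat := (size f - 2)./2.

(* Homogenization of f in degree 2g + 2 (not in degree deg f, which may be
   2g + 1). *)
Definition hyp_form (F : fieldType) (f : {poly F}) (X Z : F) : F :=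
  let d := (2 * hyp_genus f + 2)%N in
  \sum_(i < d.+1) f`_i * X ^+ i * Z ^+ (d - i).

(* Scaling on triples (X, Y, Z) with weights (1, g + 1, 1). *)
Definition wscale (F : fieldType) (g : nat) (l : F) (P : F * F * F) :
    F * F * F :=
  (l * P.1.1, l ^+ g.+1 * P.1.2, l * P.2).

(* Rational points of the projective curve Y^2 = hyp_form f X Z in the weighted
   projective plane P(1, g + 1, 1): orbits under F^* of nonzero solutions.  In
   odd characteristic, for f separable of degree 2g + 1 or 2g + 2, this curve is
   the smooth projective model of y^2 = f(x).  A nonzero solution has X or Z
   nonzero, so every F-rational point of the weighted plane that lies on the
   curve is represented by exactly one F^*-orbit of F-rational triples. *)
Definition hyp_points (F : finFieldType) (f : {poly F}) :
    {set {set F * F * F}} :=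
  [set [set wscale (hyp_genus f) l P | l : F & l != 0]
     | P in [set P : F * F * F |
               (P != (0, 0, 0)) && (P.1.2 ^+ 2 == hyp_form f P.1.1 P.2)]].

(* Coefficientwise reduction modulo p.  On 'F_p, ratr q is the quotient of the
   images of the numerator and the denominator of q, hence the residue class of
   q when q is p-integral. *)
Definition hyp_reduction (p : nat) (f : {poly rat}) : {poly 'F_p} :=
  map_poly (ratr : rat -> 'F_p) f.

(* Meaningful when the equation y^2 = f(x) has good reduction at p: f has
   p-integral coefficients, p is odd, and f mod p is separable of the same
   degree as f. *)
Definition frob_trace (p : nat) (f : {poly rat}) : int :=
  p%:Z + 1 - #|hyp_points (hyp_reduction p f)|%:Z.

Definition C2 (c : rat) : {poly rat} := 'X^7 - c *: 'X.

Lemma padic_val0_ratr_neq0 (p : nat) (c : rat) : prime p -> c != 0 ->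
  padic_val p c = 0 -> ratr c != 0 :> 'F_p.
Proof.
move=> pp c0 /eqP; rewrite /padic_val subr_eq0 eqz_nat => /eqP e.
have n0 : (0 < `|numq c|)%N by rewrite absz_gt0 numq_eq0.
have d0 : (0 < `|denq c|)%N by rewrite absz_gt0 denq_neq0.
have [n1 d1] : ~~ (p %| `|numq c|)%N /\ ~~ (p %| `|denq c|)%N.
  have cop := coprime_num_den c.
  have no : ~~ ((p %| `|numq c|)%N && (p %| `|denq c|)%N).
    rewrite -dvdn_gcd; move: cop; rewrite /coprime => /eqP ->.
    by rewrite dvdn1; case: eqP pp => // ->.
  have h m : (0 < m)%N -> (p %| m)%N = (0 < logn p m)%N.
    by move=> m0; rewrite logn_gt0 mem_primes pp m0.
  by move: no; rewrite !h // e andbb.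
have nz (z : int) : ~~ (p %| `|z|)%N -> z%:~R != 0 :> 'F_p.
  have ch := pchar_Fp pp.
  move=> h; apply: contra h; case: z => m.
    by rewrite -pmulrn (dvdn_pcharf ch) /=.
  by rewrite NegzE mulrNz oppr_eq0 -pmulrn abszN -(dvdn_pcharf ch).
by rewrite /ratr mulf_neq0 ?invr_eq0 ?nz.
Qed.

Lemma hyp_reduction_C2 (p : nat) (c : rat) :
  hyp_reduction p (C2 c) = 'X^7 - (ratr c : 'F_p) *: 'X.
Proof.
have r0 : ratr 0 = 0 :> 'F_p by rewrite /ratr mul0r.
have r1 : ratr 1 = 1 :> 'F_p by rewrite /ratr divr1.
have rN : ratr (- c) = - ratr c :> 'F_p.
  by rewrite /ratr numqN denqN mulrNz mulNr.
apply/polyP => i.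
rewrite /hyp_reduction /C2 coef_map_id0 // !coefB !coefZ !coefXn !coefX.
case: (eqVneq i 7%N) => [->|_] /=; first by rewrite !mulr0 !subr0.
by case: (eqVneq i 1%N) => _ /=; rewrite ?mulr1 ?mulr0 ?subr0 ?sub0r.
Qed.

Lemma X7_sub_scaleX_separable (F : fieldType) (a : F) :
  6%:R * a != 0 -> separable_poly ('X^7 - a *: 'X).
Proof.
move=> b0; have a0 : a != 0 by move: b0; rewrite mulf_eq0 negb_or => /andP[].
set f := _ - _.
have df : f^`() = 7%:R *: 'X^6 - a%:P.
  by rewrite /f derivB derivZ derivXn derivX /= -scaler_nat alg_polyC.
rewrite unlock; apply/coprimepP => d df1 df2.
have da : d %| a%:P.
  have dX : d %| 'X.
    have e : 'X * f^`() - 7%:R *: f = (6%:R * a) *: 'X.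
      by rewrite df /f -!mul_polyC !polyCM !polyC_natr; ring.
    by rewrite -(dvdpZr _ _ b0) -e dvdp_sub ?dvdp_mull // -mul_polyC dvdp_mull.
  have -> : a%:P = 7%:R *: 'X^6 - f^`() by rewrite df; ring.
  by rewrite dvdp_sub // -mul_polyC dvdp_mull // exprS dvdp_mulr.
by apply: dvdp_eqp1 da _; rewrite polyC_eqp1.
Qed.

(* Good reduction of y^2 = x^7 - c x at the primes considered. *)
Lemma hyp_reduction_C2_separable (p : nat) (c : rat) :
  prime p -> (3 < p)%N -> c != 0 -> padic_val p c = 0 ->
  size (hyp_reduction p (C2 c)) = size (C2 c)
  /\ separable_poly (hyp_reduction p (C2 c)).
Proof.
move=> pp p3 c0 vc; have a0 := padic_val0_ratr_neq0 pp c0 vc.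
have sz (F : fieldType) (a : F) : size ('X^7 - a *: 'X) = 8%N.
  rewrite size_polyDl ?size_polyXn // size_polyN.
  by rewrite (leq_ltn_trans (size_scale_leq _ _)) // size_polyX.
rewrite hyp_reduction_C2; split; first by rewrite /C2 !sz.
apply: X7_sub_scaleX_separable; rewrite mulf_neq0 //.
rewrite -(dvdn_pcharf (pchar_Fp pp)); apply/negP => d.
have := dvdn_leq (isT : 0 < 6)%N d.
by case: p pp p3 d {vc a0} => //; do 7!case=> //.
Qed.

(* Main.v *)
Require Import Defs.
From HB Require Import structures.
From mathcomp Require Import all_boot all_order all_algebra all_field.
From mathcomp Require Import cyclic ring zify.

Set Implicit Arguments.
Unset Strict Implicit.
Unset Printing Implicit Defensive.

Import Order.TTheory GRing.Theory Num.Theory.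
Local Open Scope ring_scope.

(** Let [f] be of odd degree over a field [F] with [q] elements, [q] odd, and
    put [n = (q - 1) / 2].  The curve [Y^2 = f] has one point at infinity
    ([card_hyp_points]).  Over a given [x] there are, in the characteristic of
    [F], [1 + f(x)^n] affine points, because [f(x)^n] is the quadratic character
    of [f(x)] ([card_sqrt_natr]).  As [q = 0] in [F], the number of points is
    [1 + \sum_x f(x)^n] in [F] ([card_hyp_points_natr]), so the trace of
    Frobenius is [- \sum_x f(x)^n] in [F].

    The sum is read off the coefficients of [f^n], since the power sum
    [\sum_x x^m] with [m > 0] is [-1] if [q - 1] divides [m] and [0] otherwise
    ([sum_expf]).  For [f = x^7 - a x] the binomial theorem gives
    [f^n = \sum_j 'C(n, j) (- a)^(n - j) x^(n + 6 j)], so the trace is the sum of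
    the ['C(n, j) (- a)^(n - j)] over the [j <= n] such that [2 n] divides
    [n + 6 j] ([frob_trace_C2]).  The divisibility says that [6 j] is an odd
    multiple of [n], hence [j] is [n / 6], [n / 2] or [5 n / 6] when these are
    integers.  All three are integers if [p = 1] modulo [12], only [n / 2] is if
    [p = 5] modulo [12], and none is for the other primes [p > 3], for which
    [n] is odd. *)

(** * Power sums and square roots in a finite field *)

Lemma expf_card_pred (F : finFieldType) (x : F) :
  x != 0 -> x ^+ #|F|.-1 = 1.
Proof.
move=> x0; apply: (mulfI x0); rewrite mulr1 -exprS prednK ?expf_card //.
exact: ltnW (finNzRing_gt1 F).
Qed.

Lemma finField_prim_root (F : finFieldType) :
  exists z : F, (#|F|.-1).-primitive_root z.
Proof.
have q1 : (0 < #|F|.-1)%N.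
  by rewrite -ltnS prednK ?(ltnW (finNzRing_gt1 F)) ?finNzRing_gt1.
have /hasP[z _ hz] :
    has (#|F|.-1).-primitive_root (enum (predC1 (0 : F))).
  apply: has_prim_root => //; first 1 last.
  - exact: enum_uniq.
  - by rewrite -cardE cardC1.
  apply/allP => x; rewrite mem_enum inE unity_rootE => x0; apply/eqP.
  exact: expf_card_pred.
by exists z.
Qed.

(** Translating the summation variable of [\sum_x x] by [1] adds [#|F|] to the
    sum. *)
Lemma finField_card_natr0 (F : finFieldType) : #|F|%:R = 0 :> F.
Proof.
have e : \sum_(x : F) x = \sum_(x : F) x + #|F|%:R.
  rewrite {1}(reindex_inj (addIr (1 : F))) big_split /=; congr (_ + _).
  by rewrite -sumr_const; apply: eq_bigl.
by apply: (addrI (\sum_(x : F) x)); rewrite -e addr0.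
Qed.

(** Replacing [x] by [z x], where [z] generates the multiplicative group,
    multiplies the sum by [z ^+ m], which differs from [1] unless [#|F|.-1]
    divides [m]; in that case every nonzero [x] contributes [1]. *)
Lemma sum_expf (F : finFieldType) (m : nat) : (0 < m)%N ->
  \sum_(x : F) x ^+ m = if (#|F|.-1 %| m)%N then -1 else 0.
Proof.
move=> m0; have q1 := finNzRing_gt1 F.
case: ifPn => [/dvdnP[k mE] | ndv].
  rewrite (bigD1 0) //= expr0n eqn0Ngt m0 add0r.
  rewrite (eq_bigr (fun=> 1)) => [|x x0]; last first.
    by rewrite mE mulnC exprM expf_card_pred // expr1n.
  rewrite sumr_const cardC1 -subn1 natrB; last exact: ltnW.
  by rewrite finField_card_natr0 sub0r.
have [z hz] := finField_prim_root F.
have z0 : z != 0.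
  apply/eqP => z00; have /eqP := prim_expr_order hz.
  by rewrite z00 expr0n eqn0Ngt (prim_order_gt0 hz) eq_sym oner_eq0.
set S := \sum_x _.
have e : (z ^+ m - 1) * S = 0.
  rewrite mulrBl mul1r {2}/S (reindex_inj (mulfI z0)) mulr_sumr.
  by apply/eqP; rewrite subr_eq0; apply/eqP/eq_bigr => x _; rewrite exprMn.
move/eqP: e; rewrite mulf_eq0 subr_eq0 -(prim_order_dvd hz) (negbTE ndv) /=.
by move/eqP.
Qed.

(** Euler's criterion, in a form that also covers [a = 0]: there [a] has a
    single square root. *)
Lemma card_sqrt_natr (F : finFieldType) (a : F) : odd #|F| ->
  #|[set y : F | y ^+ 2 == a]|%:R = 1 + a ^+ (#|F|.-1)./2 :> F.
Proof.
move=> oF; set n := (_./2)%N.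
have [qE n0] : (#|F|.-1 = 2 * n)%N /\ (0 < n)%N.
  by rewrite /n; move: #|F| oF (finNzRing_gt1 F) => q; lia.
have [-> | a0] := eqVneq a 0.
  have -> : [set y : F | y ^+ 2 == 0] = [set 0].
    by apply/setP => y; rewrite !inE sqrf_eq0.
  by rewrite cards1 expr0n eqn0Ngt n0 addr0.
have neq2 : 2%:R != 0 :> F.
  apply/eqP => e; have := finField_card_natr0 F.
  rewrite -(odd_double_half #|F|) oF natrD -muln2 natrM e mulr0 addr0 => /eqP.
  by rewrite oner_eq0.
have [[b /eqP ba] | nsq] := altP (@existsP _ (fun b : F => b ^+ 2 == a)).
  have b0 : b != 0 by apply: contraNneq a0 => b0; rewrite -ba b0 expr0n.
  have -> : [set y : F | y ^+ 2 == a] = [set b; - b].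
    by apply/setP => y; rewrite !inE -ba eqf_sqr.
  have bNb : b != - b by rewrite -addr_eq0 -mulr2n -mulr_natr mulf_neq0.
  by rewrite cards2 bNb -ba -exprM -qE expf_card_pred.
have -> : [set y : F | y ^+ 2 == a] = set0.
  by apply/setP => y; rewrite !inE; apply: contraNF nsq => h;
    apply/existsP; exists y.
have : (a ^+ n) ^+ 2 = 1 by rewrite -exprM mulnC -qE expf_card_pred.
rewrite cards0 => /eqP; rewrite sqrf_eq1 => /orP[/eqP an1 | /eqP ->]; last first.
  by rewrite subrr.
(* A power [z ^+ i] of a generator whose [n]-th power is [1] has [i] even. *)
have [z hz] := finField_prim_root F.
have [[i _] /= ai] := prim_rootP hz (expf_card_pred a0).
move/eqP: an1; rewrite ai -exprM -(prim_order_dvd hz) qE dvdn_pmul2r //.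
move=> /dvdnP[k ik]; case/existsP: nsq; exists (z ^+ k).
by rewrite ai ik exprM.
Qed.

(** * Points of a hyperelliptic curve of odd degree *)

Lemma hyp_form_scale (F : fieldType) (f : {poly F}) (l X Z : F) :
  hyp_form f (l * X) (l * Z) = (l ^+ (hyp_genus f).+1) ^+ 2 * hyp_form f X Z.
Proof.
rewrite /hyp_form mulr_sumr; apply: eq_bigr => i _; rewrite !exprMn -exprM.
set d := (2 * _ + 2)%N.
have -> : ((hyp_genus f).+1 * 2 = i + (d - i))%N by have := ltn_ord i; lia.
by rewrite exprD; ring.
Qed.

Lemma hyp_form_affine (F : fieldType) (f : {poly F}) (x : F) :
  (2 <= size f)%N -> hyp_form f x 1 = f.[x].
Proof.
move=> sf; rewrite /hyp_form (@horner_coef_wide _ (2 * hyp_genus f + 2).+1).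
  by apply: eq_bigr => i _; rewrite expr1n mulr1.
by rewrite /hyp_genus; lia.
Qed.

(** The size of [f] is even, so its degree is [2 g + 1]; the form has degree
    [2 g + 2] and is therefore divisible by [Z]. *)
Lemma hyp_form_infty (F : fieldType) (f : {poly F}) (x : F) :
  (2 <= size f)%N -> ~~ odd (size f) -> hyp_form f x 0 = 0.
Proof.
move=> sf ev; rewrite /hyp_form big1 // => -[i /= _] _.
have [lt_i | le_i] := ltnP i (2 * hyp_genus f + 2).
  by rewrite expr0n subn_eq0 leqNgt lt_i mulr0.
have sf_le_i : (size f <= i)%N by move: le_i; rewrite /hyp_genus; lia.
by rewrite nth_default ?mul0r.
Qed.

Lemma wscale1 (F : fieldType) (g : nat) (P : F * F * F) : wscale g 1 P = P.
Proof. by case: P => [[X Y] Z]; rewrite /wscale expr1n !mul1r. Qed.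

Lemma wscaleM (F : fieldType) (g : nat) (l m : F) (P : F * F * F) :
  wscale g l (wscale g m P) = wscale g (l * m) P.
Proof. by rewrite /wscale /= exprMn !mulrA. Qed.

Definition worbit (F : finFieldType) (g : nat) (P : F * F * F) :
    {set F * F * F} :=
  [set wscale g l P | l : F & l != 0].

Lemma worbit_scale (F : finFieldType) (g : nat) (l : F) (P : F * F * F) :
  l != 0 -> worbit g (wscale g l P) = worbit g P.
Proof.
move=> l0; apply/setP => Q; apply/imsetP/imsetP => -[m]; rewrite inE => m0 ->.
  by exists (m * l); rewrite ?inE ?mulf_neq0 // wscaleM.
exists (m / l); rewrite ?inE ?mulf_neq0 ?invr_eq0 //.
by rewrite wscaleM mulfVK.
Qed.

(** Each orbit contains exactly one triple of the form [(x, y, 1)], with [(x, y)]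
    on the affine curve, or [(1, 0, 0)]: scale [Z], or [X] when [Z = 0], to
    [1]. *)
Lemma card_hyp_points (F : finFieldType) (f : {poly F}) :
  (2 <= size f)%N -> ~~ odd (size f) ->
  #|hyp_points f| = #|[set u : F * F | u.2 ^+ 2 == f.[u.1]]|.+1.
Proof.
move=> sf ev; set A := [set u : F * F | _]; set g := hyp_genus f.
pose aff (u : F * F) : F * F * F := (u.1, u.2, 1).
pose infty : F * F * F := (1, 0, 0).
pose R := infty |: (aff @: A).
have inf_aff : infty \notin aff @: A.
  by apply/imsetP => -[u _ [_ _ /eqP]]; rewrite eq_sym oner_eq0.
have -> : hyp_points f = worbit g @: R.
  rewrite /hyp_points -/g; apply/setP => O; apply/imsetP/imsetP => -[P].
    rewrite inE => /andP[P0 /eqP eP] ->.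
    case: P P0 eP => [[X Y] Z] /=; have [-> | Z0] := eqVneq Z 0.
      rewrite hyp_form_infty // => P0 /eqP; rewrite sqrf_eq0 => /eqP Y0.
      rewrite {}Y0 in P0 *.
      have X0 : X != 0 by apply: contraNneq P0 => ->.
      exists infty; first exact: setU11.
      rewrite -(@worbit_scale _ g X infty X0).
      by rewrite /wscale /= mulr1 !mulr0.
    move=> _ eY; pose u := (X / Z, Y / Z ^+ g.+1).
    have sE : (X, Y, Z) = wscale g Z (aff u).
      rewrite /wscale /= mulr1 mulrCA divff // mulr1.
      by rewrite mulrCA divff ?expf_neq0 // mulr1.
    exists (aff u); last by rewrite sE; exact: worbit_scale.
    apply/setU1P; right; apply: imset_f; rewrite inE /=.
    rewrite -hyp_form_affine //.
    apply/eqP; apply: (@mulfI _ ((Z ^+ g.+1) ^+ 2)); first by rewrite !expf_neq0.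
    rewrite -hyp_form_scale mulr1 -exprMn.
    by rewrite mulrCA divff ?expf_neq0 // mulr1 [Z * _]mulrC mulfVK.
  case/setU1P => [-> -> | /imsetP[u uA ->] ->].
    exists infty => //; rewrite inE /= hyp_form_infty // expr0n /= eqxx andbT.
    by apply/eqP => -[/eqP]; rewrite oner_eq0.
  move: uA; rewrite inE => eu.
  exists (aff u) => //; rewrite inE /= hyp_form_affine // eu andbT.
  by apply/eqP => -[_ _ /eqP]; rewrite oner_eq0.
rewrite card_in_imset; last first.
  move=> P Q PR QR ePQ.
  have : P \in worbit g Q.
    by rewrite -ePQ; apply/imsetP; exists 1; rewrite ?inE ?oner_neq0 ?wscale1.
  case/imsetP => l; rewrite inE => l0 ePl.
  suff l1 : l = 1 by rewrite ePl l1 wscale1.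
  case/setU1P: PR ePl => [-> | /imsetP[u _ ->]];
    case/setU1P: QR => [-> | /imsetP[v _ ->]] [].
  - by rewrite mulr1.
  - by move=> _ _ /esym/eqP; rewrite mulr1 (negbTE l0).
  - by move=> _ _ /eqP; rewrite mulr0 oner_eq0.
  - by move=> _ _; rewrite mulr1.
rewrite cardsU1 inf_aff card_imset // => -[x y] [x' y'] [-> ->] //.
Qed.

(** The constant terms [1] contributed by the fibres over the points of the
    affine line add up to [#|F|], which vanishes in [F]. *)
Lemma card_hyp_points_natr (F : finFieldType) (f : {poly F}) :
  odd #|F| -> (2 <= size f)%N -> ~~ odd (size f) ->
  #|hyp_points f|%:R = 1 + \sum_(x : F) f.[x] ^+ (#|F|.-1)./2 :> F.
Proof.
move=> oF sf ev; rewrite card_hyp_points // -add1n natrD; congr (_ + _).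
rewrite -sum1_card natr_sum.
rewrite (eq_bigl (fun u : F * F => xpredT u.1 && (u.2 ^+ 2 == f.[u.1]))); last first.
  by move=> u; rewrite inE.
rewrite -(pair_big_dep xpredT (fun x y => y ^+ 2 == f.[x]) (fun _ _ => 1)) /=.
transitivity (\sum_(x : F) (1 + f.[x] ^+ (#|F|.-1)./2)).
  apply: eq_bigr => x _; rewrite -card_sqrt_natr // -sum1_card natr_sum.
  by apply: eq_bigl => y; rewrite inE.
by rewrite big_split /= sumr_const finField_card_natr0 add0r.
Qed.

(** * The curve y^2 = x^7 - c x *)

Lemma sum_X7_sub_scaleX (F : finFieldType) (a : F) (n : nat) : (0 < n)%N ->
  \sum_(x : F) ('X^7 - a *: 'X).[x] ^+ n =
  - \sum_(j < n.+1 | (#|F|.-1 %| n + 6 * j)%N) 'C(n, j)%:R * (- a) ^+ (n - j).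
Proof.
move=> n0.
transitivity (\sum_(x : F) \sum_(j < n.+1)
    'C(n, j)%:R * (- a) ^+ (n - j) * x ^+ (n + 6 * j)).
  apply: eq_bigr => x _; rewrite !hornerE.
  have -> : x ^+ 7 - a * x = x * (- a + x ^+ 6) by ring.
  rewrite exprMn exprDn mulr_sumr; apply: eq_bigr => j _.
  by rewrite exprD exprM -mulr_natl; ring.
rewrite exchange_big -sumrN [RHS]big_mkcond; apply: eq_bigr => j _.
rewrite -mulr_sumr sum_expf ?addn_gt0 ?n0 //.
by case: ifP; rewrite ?mulr0 ?mulrN1.
Qed.

Lemma frob_trace_C2 (c : rat) (p : nat) : prime p -> (3 < p)%N ->
  let n := (p.-1)./2 in
  (frob_trace p (C2 c))%:~R =
    \sum_(j < n.+1 | (2 * n %| n + 6 * j)%N)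
       'C(n, j)%:R * (- ratr c) ^+ (n - j) :> 'F_p.
Proof.
move=> hp p3 n; have oddp : odd p by have := even_prime hp; lia.
have sz : size ('X^7 - (ratr c : 'F_p) *: 'X) = 8%N.
  rewrite size_polyDl ?size_polyXn // size_polyN.
  by rewrite (leq_ltn_trans (size_scale_leq _ _)) // size_polyX.
rewrite /frob_trace hyp_reduction_C2 rmorphB rmorphD /=.
rewrite -!pmulrn card_hyp_points_natr ?card_Fp ?sz // pchar_Fp_0 // -/n.
rewrite sum_X7_sub_scaleX ?card_Fp //; last by rewrite /n; lia.
have -> : p.-1 = (2 * n)%N by rewrite /n; lia.
ring.
Qed.

Theorem mainTheorem3 (c : rat) (p : nat)
    (hc : c != 0) (hp : prime p) (hp3 : (3 < p)%N)
    (hv : padic_val p c = 0) :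
  let n := ((p - 1) %/ 2)%N in
  let cbar : 'F_p := ratr c in
  (frob_trace p (C2 c))%:~R =
    (if (p %% 12 == 1)%N then
       'C(n, n %/ 2)%:R * (- cbar) ^+ (n %/ 2)
       + 'C(n, n %/ 6)%:R * (- cbar) ^+ (n %/ 6)
       + 'C(n, n %/ 6)%:R * (- cbar) ^+ ((5 * n) %/ 6)
     else if (p %% 12 == 5)%N then
       'C(n, n %/ 2)%:R * (- cbar) ^+ (n %/ 2)
     else 0) :> 'F_p.
Proof.
move=> n cbar; rewrite frob_trace_C2 //= -/cbar.
have -> : (p.-1)./2 = n by rewrite /n; lia.
have oddp : odd p by have := even_prime hp; lia.
have n3 : ~~ (3 %| p)%N by rewrite dvdn_prime2 //; lia.
case: ifP => [p1 | p1]; last case: ifP => p5.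
- pose m := (p %/ 12)%N.
  have nE : n = (6 * m)%N by rewrite /n /m; lia.
  have m0 : (0 < m)%N by rewrite /m; lia.
  have -> : (n %/ 2 = 3 * m)%N by lia.
  have -> : (n %/ 6 = m)%N by lia.
  have -> : ((5 * n) %/ 6 = 5 * m)%N by lia.
  have [h1 h3 h5] : [/\ m < n.+1, 3 * m < n.+1 & 5 * m < n.+1]%N by split; lia.
  (* [2 n] divides [n + 6 j] only for [j = m], [3 m] and [5 m], with quotients
     [1], [2] and [3]. *)
  rewrite (bigD1 (Ordinal h3)) /=; last by apply/dvdnP; exists 2%N; lia.
  rewrite (bigD1 (Ordinal h5)) /=; last first.
    by apply/andP; split; [apply/dvdnP; exists 3%N | rewrite -val_eqE /=]; lia.
  rewrite (bigD1 (Ordinal h1)) /=; last first.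
    rewrite -!val_eqE /= -andbA; apply/and3P; split; [apply/dvdnP; exists 1%N | |]; lia.
  rewrite big_pred0 => [|[j lt_j]]; last first.
    rewrite -!val_eqE /=; apply/negP => /andP[/andP[/andP[/dvdnP[k jE] j3] j5] j1].
    (* The quotient is at most [3], because [n + 6 j <= 7 n]. *)
    have k4 : (k < 4)%N by nia.
    by case: k k4 jE => [|[|[|[|k]]]] // _ jE; nia.
  rewrite addr0 addrA.
  have -> : (n - 3 * m = 3 * m)%N by lia.
  have -> : (n - 5 * m = m)%N by lia.
  have -> : (n - m = 5 * m)%N by lia.
  rewrite -[in 'C(n, 5 * m)]bin_sub; last by lia.
  by have -> : (n - 5 * m = m)%N by lia.
- pose m := (p %/ 12)%N.
  have nE : n = (6 * m + 2)%N by rewrite /n /m; lia.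
  have -> : (n %/ 2 = 3 * m + 1)%N by lia.
  (* Neither [n] nor [5 n] is a multiple of [6], which leaves the quotient [2]. *)
  have h : (3 * m + 1 < n.+1)%N by lia.
  rewrite (bigD1 (Ordinal h)) /=; last by apply/dvdnP; exists 2%N; lia.
  rewrite big_pred0 => [|[j lt_j]]; last first.
    rewrite -!val_eqE /=; apply/negP => /andP[/dvdnP[k jE] j3].
    have k4 : (k < 4)%N by nia.
    by case: k k4 jE => [|[|[|[|k]]]] // _ jE; lia.
  by rewrite addr0; have -> : (n - (3 * m + 1) = 3 * m + 1)%N by lia.
(* Now [n] is odd, so [n + 6 j] is odd too. *)
- apply: big_pred0 => -[j /= _]; apply/negbTE/negP => /dvdnP[k].
  by lia.
Qed.
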